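(* For a sequence of integers $A=(a_1,a_2,\ldots,a_r)$ with $a_1\ge a_2\ge\cdots\ge a_r\ge 2$, put $s_i=a_1+a_2+\cdots+a_i$ (and $s_0=0$), and, when $s_r\le n$, let $$\beta_A=(x_1x_2\cdots x_{s_1-1})(x_{s_1+1}\cdots x_{s_2-1})\cdots(x_{s_{r-1}+1}\cdots x_{s_r-1})\in\mathcal{B}_n$$ (the empty sequence, $r=0$, giving the trivial braid). (a) A positive braid in $\mathcal{B}_n$ is simple if and only if it is conjugate to $\beta_A$ for some such sequence $A$. (b) The HOMFLY polynomial $P_n(\beta_A)$ of the closure of the $n$-braid $\beta_A$ is $$P_n(\beta_A)(l,m)=\Big(-\frac{l+l^{-1}}{m}\Big)^{n-s_r+r-1}.$$
   Context: $\mathcal{B}_n$ is the braid group on $n$ strands with Artin generators $x_1,\ldots,x_{n-1}$, and a positive braid is an element of the monoid $\mathcal{MB}_n$ of products of the generators $x_i$ (without inverses). A positive braid $\beta\in\mathcal{MB}_n$ is called simple if one presentation of $\beta$ as a positive word contains no repeated generator $x_i$ (in this case every presentation of $\beta$ as a positive word has the same property); equivalently, if all conjugates of $\beta$ in $\mathcal{MB}_n$ are square free. Two positive braids $\alpha,\alpha'$ are conjugate in $\mathcal{B}_n$ if and only if they are conjugate in $\mathcal{MB}_n$, i.e. there is a positive braid $\gamma$ with $\alpha\gamma=\gamma\alpha'$. The HOMFLY polynomial is the oriented link invariant $P$ with values in $\mathbb{C}[l^{\pm1},m^{\pm1}]$ determined by $P(\bigcirc)=1$ (unknot) and the skein relation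 $lP(L_+)+l^{-1}P(L_-)+mP(L_0)=0$ whenever $L_+,L_-,L_0$ are oriented diagrams identical except near one crossing, where $L_+$ has a positive crossing (both strands pointing up, the over-strand goes from lower left to upper right), $L_-$ a negative crossing and $L_0$ the oriented smoothing. Braid convention: in $x_i$ the strand going from top position $i$ to bottom position $i+1$ passes over the strand going from top position $i+1$ to bottom position $i$. Braids are oriented from top to bottom, so each crossing $x_i$ in the closure of a braid is a negative crossing (type $L_-$). *)

(* Defs.v *)
From HB Require Import structures.
From mathcomp Require Import all_boot all_order all_algebra.
From mathcomp Require Import generic_quotient fraction complex.
From mathcomp Require Import boolp reals.

Set Implicit Arguments.
Unset Strict Implicit.
Unset Printing Implicit Defensive.

Import GRing.Theory.
Local Open Scope quotient_scope.

(* Indices are 1-based: the generators are x_1, ..., x_(n-1). *)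
Definition artin_index (n : nat) := {i : nat | 0 < i < n}.

(* The letter (i, true) stands for x_i, the letter (i, false) for x_i^-1. *)
Definition braid_word (n : nat) := seq (artin_index n * bool).

Inductive braid_eq (n : nat) : braid_word n -> braid_word n -> Prop :=
| BraidRefl u : braid_eq u u
| BraidSym u v : braid_eq u v -> braid_eq v u
| BraidTrans u v w : braid_eq u v -> braid_eq v w -> braid_eq u w
| BraidCat u u' v v' :
    braid_eq u u' -> braid_eq v v' -> braid_eq (u ++ v) (u' ++ v')
| BraidCancel i b : braid_eq [:: (i, b); (i, ~~ b)] [::]
| BraidFar i j : (val i).+1 < val j ->
    braid_eq [:: (i, true); (j, true)] [:: (j, true); (i, true)]
| BraidArtin i j : val j = (val i).+1 ->
    braid_eq [:: (i, true); (j, true); (i, true)]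
             [:: (j, true); (i, true); (j, true)].

Definition braid_eqb n : rel (braid_word n) := fun u v => `[< braid_eq u v >].

Lemma braid_eqb_is_equiv n : equiv_class_of (@braid_eqb n).
Proof.
split=> [u|u v|v u w]; first exact/asboolP/BraidRefl.
- by apply/asboolP/asboolP; apply: BraidSym.
- by move=> /asboolP uv /asboolP vw; apply/asboolP/(BraidTrans uv).
Qed.

Canonical braid_equiv n := EquivRelPack (braid_eqb_is_equiv n).

Definition braid (n : nat) := {eq_quot (braid_equiv n)}.

HB.instance Definition _ n := Choice.on (braid n).
HB.instance Definition _ n := EqQuotient.on (braid n).

Section BraidGroup.
Variable n : nat.
Implicit Types (u v w : braid_word n) (x y z : braid n).

Definition braid_of (w : braid_word n) : braid n := \pi_(braid n) w.

Lemma braid_ofP u v : braid_of u = braid_of v <-> braid_eq u v.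
Proof. by split=> [/eqmodP/asboolP|uv] //; apply/eqmodP/asboolP. Qed.

Lemma braid_of_repr x : braid_of (repr x) = x. Proof. exact: reprK. Qed.

Lemma repr_braid_of w : braid_eq (repr (braid_of w)) w.
Proof. exact/braid_ofP/braid_of_repr. Qed.

Definition inv_word w : braid_word n := rev [seq (l.1, ~~ l.2) | l <- w].

Lemma inv_word_cat u v : inv_word (u ++ v) = inv_word v ++ inv_word u.
Proof. by rewrite /inv_word map_cat rev_cat. Qed.

Lemma inv_wordl w : braid_eq (inv_word w ++ w) [::].
Proof.
elim: w => [|[i b] w IHw]; first exact: BraidRefl.
rewrite -cat1s inv_word_cat -catA.
apply: BraidTrans IHw; apply: BraidCat (BraidRefl _) _; rewrite catA.
apply: (@BraidCat n _ [::] w w) (BraidRefl _).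
by rewrite -[X in _ ++ [:: (i, X)]](negbK b); apply: BraidCancel.
Qed.

Lemma inv_wordK : involutive inv_word.
Proof.
move=> w; rewrite /inv_word map_rev revK -map_comp -[RHS]map_id.
by apply: eq_map => -[i b] /=; rewrite negbK.
Qed.

Lemma inv_wordr w : braid_eq (w ++ inv_word w) [::].
Proof. by rewrite -{1}[w]inv_wordK; apply: inv_wordl. Qed.

Lemma inv_word_eq u v : braid_eq u v -> braid_eq (inv_word u) (inv_word v).
Proof.
move=> uv; rewrite -[inv_word u]cats0 -[inv_word v]cat0s.
apply: BraidTrans (BraidCat (inv_wordl u) (BraidRefl _)); rewrite -catA.
apply: BraidCat (BraidRefl _) _; apply: BraidSym.
exact: BraidTrans (BraidCat uv (BraidRefl _)) (inv_wordr v).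
Qed.

Definition braid_mul x y := braid_of (repr x ++ repr y).
Definition braid_inv x := braid_of (inv_word (repr x)).

Lemma braid_of_cat u v : braid_of (u ++ v) = braid_mul (braid_of u) (braid_of v).
Proof.
apply/braid_ofP; apply: BraidCat; exact: BraidSym (repr_braid_of _).
Qed.

Lemma braid_of_inv w : braid_of (inv_word w) = braid_inv (braid_of w).
Proof. exact/braid_ofP/inv_word_eq/BraidSym/repr_braid_of. Qed.

Lemma braid_mulA : associative braid_mul.
Proof.
move=> x y z; rewrite -[x]braid_of_repr -[y]braid_of_repr -[z]braid_of_repr.
by rewrite -!braid_of_cat catA.
Qed.

Lemma braid_mul1 : left_id (braid_of [::]) braid_mul.
Proof. by move=> x; rewrite -{1}[x]braid_of_repr -braid_of_cat braid_of_repr. Qed.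

Lemma braid_mulx1 : right_id (braid_of [::]) braid_mul.
Proof.
by move=> x; rewrite -{1}[x]braid_of_repr -braid_of_cat cats0 braid_of_repr.
Qed.

Lemma braid_mulV : left_inverse (braid_of [::]) braid_inv braid_mul.
Proof.
move=> x; rewrite -[x]braid_of_repr -braid_of_inv -braid_of_cat.
exact/braid_ofP/inv_wordl.
Qed.

Lemma braid_mulxV : right_inverse (braid_of [::]) braid_inv braid_mul.
Proof.
move=> x; rewrite -[x]braid_of_repr -braid_of_inv -braid_of_cat.
exact/braid_ofP/inv_wordr.
Qed.

HB.instance Definition _ := isGroup.Build (braid n)
  braid_mulA braid_mul1 braid_mulx1 braid_mulV braid_mulxV.

End BraidGroup.

Local Open Scope group_scope.

(* The Artin generator x_j; the value 1 for j outside [1, n-1] is junk. *)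
Definition artin n (j : nat) : braid n :=
  if insub j is Some i then braid_of [:: (i : artin_index n, true)] else 1.

Definition positive_product n (w : seq (artin_index n)) : braid n :=
  \prod_(i <- w) artin n (val i).

Definition positive_braid n (b : braid n) : Prop :=
  exists w, b = positive_product w.

Definition simple_braid n (b : braid n) : Prop :=
  exists2 w, uniq w & b = positive_product w.

Definition conjugate_braids n (a b : braid n) : Prop := exists g, a ^ g = b.

Definition block_sequence n (A : seq nat) : bool :=
  [&& sorted geq A, all (leq 2) A & sumn A <= n].

Definition block_sum (A : seq nat) (i : nat) : nat := sumn (take i A).

Definition beta n (A : seq nat) : braid n :=
  \prod_(1 <= i < (size A).+1)
    \prod_((block_sum A i.-1).+1 <= j < block_sum A i) artin n j.

(* A plane diagram in general position with respect to the height function is *)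
(* cut by horizontal lines into slabs, each containing one local maximum, one *)
(* local minimum or one crossing; it is the list of these events from top to  *)
(* bottom. The index i is the number of strands to the left of the event, so  *)
(* that its strands are in the (0-based) positions i and i + 1.               *)
Inductive event :=
(* b = true: the left end of the arc is oriented downwards, the right upwards *)
| LocalMax (i : nat) (b : bool)
| LocalMin (i : nat)
(* b = true: the strand going from the top left to the bottom right is over   *)
| Crossing (i : nat) (b : bool).

Definition diagram := seq event.

(* The orientations of the strands met by a horizontal line, from left to     *)
(* right, true meaning downwards. The function computes those below an event  *)
(* from those above, and fails if the event does not fit.                     *)
Definition step (s : seq bool) (e : event) : option (seq bool) :=
  match e with
  | LocalMax i b =>
      if i <= size s then Some (take i s ++ [:: b, ~~ b & drop i s]) else None
  | LocalMin i =>
      if drop i s is [:: a, b & s'] then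
        if a != b then Some (take i s ++ s') else None
      else None
  | Crossing i _ =>
      if drop i s is [:: a, b & s'] then Some (take i s ++ [:: b, a & s'])
      else None
  end.

Definition run (s : seq bool) (d : diagram) : option (seq bool) :=
  foldl (fun os e => obind (step^~ e) os) (Some s) d.

Definition link_diagram (d : diagram) : bool := run [::] d == Some [::].

Definition shift_event (k : nat) (e : event) : event :=
  match e with
  | LocalMax i b => LocalMax (k + i) b
  | LocalMin i => LocalMin (k + i)
  | Crossing i b => Crossing (k + i) b
  end.

(* The first position to the right of the event, above and below it. *)
Definition above_end (e : event) : nat :=
  match e with LocalMax i _ => i | LocalMin i | Crossing i _ => i.+2 end.
Definition below_end (e : event) : nat :=
  match e with LocalMin i => i | LocalMax i _ | Crossing i _ => i.+2 end.

(* Turaev's and Freyd-Yetter's moves: the first five generate the isotopies   *)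
(* of the plane, the others are the Reidemeister moves. In MoveR3 the         *)
(* condition says that one of the three strands is over the two others, one   *)
(* under the two others; it excludes the cyclic configurations.               *)
Inductive local_move : diagram -> diagram -> Prop :=
| MoveFar e f :
    local_move [:: e; shift_event (below_end e) f]
               [:: shift_event (above_end e) f; e]
| MoveZigzagL i b : local_move [:: LocalMax i.+1 b; LocalMin i] [::]
| MoveZigzagR i b : local_move [:: LocalMax i b; LocalMin i.+1] [::]
| MoveSlideMax i b c :
    local_move [:: LocalMax i.+1 b; Crossing i c]
               [:: LocalMax i b; Crossing i.+1 (~~ c)]
| MoveSlideMin i c :
    local_move [:: Crossing i c; LocalMin i.+1]
               [:: Crossing i.+1 (~~ c); LocalMin i]
| MoveR1Max i b c :
    local_move [:: LocalMax i b; Crossing i c] [:: LocalMax i (~~ b)]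
| MoveR1Min i c : local_move [:: Crossing i c; LocalMin i] [:: LocalMin i]
| MoveR2 i c : local_move [:: Crossing i c; Crossing i (~~ c)] [::]
| MoveR3 i a b c : (a == b) || (b == c) ->
    local_move [:: Crossing i a; Crossing i.+1 b; Crossing i c]
               [:: Crossing i.+1 c; Crossing i b; Crossing i.+1 a].

Inductive same_link : diagram -> diagram -> Prop :=
| SameRefl d : same_link d d
| SameSym d d' : same_link d d' -> same_link d' d
| SameTrans d d' d'' : same_link d d' -> same_link d' d'' -> same_link d d''
| SameMove d1 u v d2 : local_move u v ->
    link_diagram (d1 ++ u ++ d2) -> link_diagram (d1 ++ v ++ d2) ->
    same_link (d1 ++ u ++ d2) (d1 ++ v ++ d2).

Definition unknot : diagram := [:: LocalMax 0 true; LocalMin 0].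

Definition braid_letter n (l : artin_index n * bool) : event :=
  Crossing (val l.1).-1 l.2.

(* The n strands of the braid are oriented from top to bottom and closed by   *)
(* nested arcs on the right.                                                  *)
Definition braid_closure n (w : braid_word n) : diagram :=
  [seq LocalMax i true | i <- iota 0 n] ++ [seq braid_letter l | l <- w]
    ++ [seq LocalMin i | i <- rev (iota 0 n)].

Local Open Scope ring_scope.

(* C[l, m], as polynomials in m over C[l]; C[l^+-1, m^+-1] is seen as a       *)
(* subring of its fraction field.                                             *)
Definition poly_lm (R : realType) := {poly {poly R[i]}}.
Definition frac_lm (R : realType) := {fraction (poly_lm R)}.

Definition var_l (R : realType) : frac_lm R := tofrac ('X%:P : poly_lm R).
Definition var_m (R : realType) : frac_lm R := tofrac ('X : poly_lm R).

Definition is_laurent (R : realType) (f : frac_lm R) : Prop :=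
  exists (p : poly_lm R) (i j : nat), f = tofrac p / (var_l R ^+ i * var_m R ^+ j).

Definition parallel_strands (s : seq bool) (i : nat) : bool :=
  (i.+1 < size s)%N && (nth true s i == nth true s i.+1).

(* With both strands oriented upwards, Crossing i false is L_+ and            *)
(* Crossing i true is L_-; rotating the plane by a half turn, this also holds *)
(* with both strands oriented downwards.                                      *)
Record is_homfly (R : realType) (P : diagram -> frac_lm R) : Prop := {
  homfly_laurent : forall d, link_diagram d -> is_laurent (P d);
  homfly_invariant : forall d d', link_diagram d -> link_diagram d' ->
    same_link d d' -> P d = P d';
  homfly_unknot : P unknot = 1;
  homfly_skein : forall d1 d2 s i,
    run [::] d1 = Some s -> parallel_strands s i -> link_diagram (d1 ++ d2) ->
    var_l R * P (d1 ++ Crossing i false :: d2)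
      + (var_l R)^-1 * P (d1 ++ Crossing i true :: d2)
      + var_m R * P (d1 ++ d2) = 0 }.

(* The closure depends on the word chosen to represent b only up to           *)
(* same_link, so f is required to be the value for all of them.               *)
Definition braid_homfly_eq (R : realType) n (P : diagram -> frac_lm R)
    (b : braid n) (f : frac_lm R) : Prop :=
  forall w : braid_word n, braid_of w = b -> P (braid_closure w) = f.

(* Main.v *)
Require Import Defs.
From mathcomp Require Import all_boot all_order all_algebra all_fingroup.
From mathcomp Require Import complex reals zify.

(* (a) Two positive words without repetitions and with the same letters have
   conjugate products, by commutations and cyclic shifts, and conjugating by the
   half twist of two adjacent blocks of strands exchanges their lengths; so a
   simple braid is conjugate to the beta_A of the sorted block lengths.
   Conversely the number of letters of a positive word and the cycle type of its
   permutation are conjugacy invariants in the braid group, and a product of k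
   transpositions (i, i+1), d of them distinct, has at least n - d cycles, with
   equality when d = k. So a positive word of length k conjugate to a square
   free one has d >= k.
   (b) If x_(n-1) occurs exactly once, the last strand can be removed by planar
   isotopy and one Reidemeister I move. If it does not occur, the last strand is
   a free circle; inserting a crossing of either sign next to it gives back the
   link without the circle, so the skein relation gives the factor
   -(l + l^-1)/m. *)

Set Implicit Arguments.
Unset Strict Implicit.
Unset Printing Implicit Defensive.

Local Open Scope group_scope.

(** * Conjugacy of square free positive words *)

Section Artin.
Variable n : nat.
Implicit Types (g h : braid n) (w u v : seq nat).

Lemma braid_ofM (u v : braid_word n) :
  braid_of (u ++ v) = braid_of u * braid_of v.
Proof. exact: braid_of_cat. Qed.

Lemma artin_in (i : artin_index n) : artin n (val i) = braid_of [:: (i, true)].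
Proof. by rewrite /artin valK. Qed.

Lemma artin_out j : ~~ (0 < j < n) -> artin n j = 1.
Proof. by move=> /negbTE jn; rewrite /artin insubF. Qed.

Lemma artin_far i j : i.+1 < j -> commute (artin n i) (artin n j).
Proof.
move=> lt_ij; have [i_in|/artin_out->] := boolP (0 < i < n); last first.
  exact/commute_sym/commute1.
have [j_in|/artin_out->] := boolP (0 < j < n); last exact: commute1.
rewrite /commute (artin_in (Sub i i_in)) (artin_in (Sub j j_in)) -!braid_ofM.
exact/braid_ofP/BraidFar.
Qed.

Lemma artin_commute i j :
  (i.+1 < j) || (j.+1 < i) -> commute (artin n i) (artin n j).
Proof. by case/orP=> /artin_far // /commute_sym. Qed.

Lemma artin_braid i : 0 < i -> i.+1 < n ->
  artin n i * artin n i.+1 * artin n i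
  = artin n i.+1 * artin n i * artin n i.+1.
Proof.
move=> i0 iSn; have i_in : 0 < i < n by rewrite i0 ltnW.
rewrite (artin_in (Sub i i_in)) (artin_in (Sub i.+1 iSn)) -!braid_ofM.
exact/braid_ofP/BraidArtin.
Qed.

(** Letters are plain naturals, so that [iota], filters and reflections of words carry no range
    proofs; a letter out of range contributes 1. *)
Definition artin_prod (w : seq nat) : braid n := \prod_(j <- w) artin n j.

Lemma artin_prod_cat u v : artin_prod (u ++ v) = artin_prod u * artin_prod v.
Proof. by rewrite /artin_prod big_cat. Qed.

Lemma artin_prod_cons j w : artin_prod (j :: w) = artin n j * artin_prod w.
Proof. by rewrite /artin_prod big_cons. Qed.

Lemma artin_prod1 j : artin_prod [:: j] = artin n j.
Proof. by rewrite /artin_prod big_seq1. Qed.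

Lemma artin_prod0 : artin_prod [::] = 1.
Proof. by rewrite /artin_prod big_nil. Qed.

Lemma commute_artin_prod g w :
  {in w, forall j, commute (artin n j) g} -> commute (artin_prod w) g.
Proof.
move=> wg; rewrite /artin_prod big_seq.
apply: (big_ind (fun x => commute x g)) => [|x y|j /wg //].
- exact/commute_sym/commute1.
- by move=> /commute_sym gx /commute_sym gy; apply/commute_sym/commuteM.
Qed.

Lemma conj_refl (a : braid n) : conjugate_braids a a.
Proof. by exists 1; rewrite conjg1. Qed.

Lemma conj_sym (a b : braid n) : conjugate_braids a b -> conjugate_braids b a.
Proof. by case=> g <-; exists g^-1; rewrite conjgK. Qed.

Lemma conj_trans (a b c : braid n) :
  conjugate_braids a b -> conjugate_braids b c -> conjugate_braids a c.
Proof. by case=> g <- [h <-]; exists (g * h); rewrite conjgM. Qed.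

Lemma conj_mulC (a b : braid n) : conjugate_braids (a * b) (b * a).
Proof. by exists a; rewrite conjgE mulgA mulKg. Qed.

(* Since [m.-1] occurs on at most one side of [m] in [w], commutations bring [m]
   to an end of [w] and a conjugation to the right end, where it joins [h]. *)
Lemma uniq_conj_ordered m w h :
  (forall j, j.+1 < m -> commute (artin n j) h) -> uniq w ->
  all (gtn m) w ->
  conjugate_braids (artin_prod w * h)
    (artin_prod [seq j <- iota 0 m | j \in w] * h).
Proof.
elim: m => [|m IHm] in w h *.
  by case: w => //= _ _ _; apply: conj_refl.
move=> hC uw wm; rewrite -addn1 iotaD filter_cat add0n /=.
have [m_w|m_w] := boolP (m \in w); last first.
  rewrite cats0; apply: IHm => // [j jm|]; first by apply: hC; lia.
  apply/allP=> j jw; have := allP wm _ jw.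
  by rewrite /= ltnS leq_eqVlt => /orP[/eqP ej|//]; rewrite -ej jw in m_w.
rewrite artin_prod_cat artin_prod1 -mulgA.
case/splitPr: m_w uw wm => u v; rewrite -cat1s uniq_catCA /= => /andP[muv uuv].
move=> wm.
have uvm : all (gtn m) (u ++ v).
  apply/allP=> j juv; have jm : j != m by apply: contraNneq muv => <-.
  have /(allP wm) /= : j \in u ++ [:: m] ++ v.
    by move: juv; rewrite !mem_cat => /orP[] ->; rewrite ?orbT.
  lia.
have -> : [seq j <- iota 0 m | j \in u ++ m :: v]
        = [seq j <- iota 0 m | j \in u ++ v].
  apply: eq_in_filter => j; rewrite mem_iota /= => jm.
  rewrite !mem_cat !inE; suff -> : (j == m) = false by [].
  by apply/negbTE; lia.
(* The right factor grows to [artin n m * h]. The induction asks it to commute only with x_j for j +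
   1 < m, and such x_j commute with x_m. *)
apply: (@conj_trans _ (artin_prod (u ++ v) * (artin n m * h))); last first.
  apply: IHm => // j jm; apply: commuteM; last by apply: hC; lia.
  by apply: artin_commute; rewrite jm.
rewrite !artin_prod_cat artin_prod_cons.
have [vm|/allPn[k kv km]] := boolP (all (fun j => j.+1 < m) v).
  have mv : commute (artin_prod v) (artin n m).
    by apply: commute_artin_prod => j /(allP vm); apply: artin_far.
  rewrite -mv -!mulgA; exact: conj_refl.
have mu : commute (artin_prod u) (artin n m).
  apply: commute_artin_prod => j ju; apply: artin_far.
  have : j != k.
    apply: contraTneq uuv => ejk; rewrite cat_uniq !negb_and.
    by rewrite negbK; apply/or3P/Or32/hasP; exists k; rewrite -?ejk //= ejk.
  have : k < m by apply: (allP uvm); rewrite mem_cat kv orbT.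
  have : j < m by apply: (allP uvm); rewrite mem_cat ju.
  move: km; rewrite -leqNgt; lia.
have uvh : commute (artin_prod (u ++ v)) h.
  by apply: commute_artin_prod => j /(allP uvm) jm; apply: hC.
rewrite [artin_prod u * (_ * _)]mulgA mu -[artin n m * _ * artin_prod v]mulgA.
rewrite -artin_prod_cat -mulgA uvh mulgA; exact: conj_mulC.
Qed.

(** Both products are conjugate to that of the increasing word on the common letters. *)
Lemma uniq_conj_perm u v : uniq u -> uniq v -> u =i v ->
  conjugate_braids (artin_prod u) (artin_prod v).
Proof.
move=> uu uv euv; pose m := (\max_(j <- u) j).+1.
have um : all (gtn m) u.
  by apply/allP=> j ju /=; rewrite ltnS; apply: (leq_bigmax_seq (F := id)).
have vm : all (gtn m) v by rewrite -(eq_all_r euv).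
have ef : [seq j <- iota 0 m | j \in u] = [seq j <- iota 0 m | j \in v].
  exact: eq_filter.
have h1 (j : nat) : j.+1 < m -> commute (artin n j) 1 by move=> _;
  exact: commute1.
have := conj_trans (uniq_conj_ordered h1 uu um).
rewrite ef !mulg1; apply; have := uniq_conj_ordered h1 uv vm.
by rewrite !mulg1 => /conj_sym.
Qed.

(** * The half twist of a block of adjacent strands *)

Definition strands_word (p m : nat) : seq nat := iota p.+1 m.-1.

Lemma strands_wordS p m : 0 < m ->
  strands_word p m.+1 = rcons (strands_word p m) (p + m).
Proof.
case: m => // m _; rewrite /strands_word !PeanoNat.Nat.pred_succ.
by rewrite -[m.+1 in LHS]addn1 iotaD -cats1 addSnnS.
Qed.

(** Garside's half twist of the strands p + 1, ..., p + m, counted from 1. *)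
Fixpoint half_twist (p m : nat) : braid n :=
  if m is m'.+1 then artin_prod (strands_word p m) * half_twist p m' else 1.

Lemma strands_artin_prodS p m : 0 < m ->
  artin_prod (strands_word p m.+1) =
    artin_prod (strands_word p m) * artin n (p + m).
Proof. by move=> m0; rewrite strands_wordS // -cats1 artin_prod_cat
  artin_prod1. Qed.

Lemma strands_commute p m j : (j < p) || (p + m < j) ->
  commute (artin_prod (strands_word p m)) (artin n j).
Proof.
move=> jpm; apply: commute_artin_prod => i; rewrite mem_iota => ipm.
by apply: artin_commute; lia.
Qed.

(** x_(p+i+1) passes the letters before x_(p+i), becomes x_(p+i) by the braid relation with x_(p+i)
    x_(p+i+1), and passes the rest. *)
Lemma strands_shift p m i : 0 < i -> i.+1 < m -> p + m <= n ->
  artin n (p + i.+1) * artin_prod (strands_word p m)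
  = artin_prod (strands_word p m) * artin n (p + i).
Proof.
move=> i0; elim: m => // m IHm; rewrite ltnS leq_eqVlt => /orP[/eqP <-|im] pmn.
  have -> : artin_prod (strands_word p i.+2)
    = artin_prod (strands_word p i) * (artin n (p + i) * artin n (p + i).+1).
    by rewrite (strands_artin_prodS p (ltn0Sn i)) (strands_artin_prodS p i0)
      addnS mulgA.
  have c : commute (artin_prod (strands_word p i)) (artin n (p + i).+1).
    by apply: strands_commute; lia.
  rewrite addnS [LHS]mulgA -c -!mulgA; congr (_ * _).
  by rewrite !mulgA artin_braid //; lia.
rewrite strands_artin_prodS; last lia.
rewrite mulgA IHm //; last lia.
by rewrite -!mulgA; congr (_ * _); apply: artin_far; lia.
Qed.

Lemma half_twistS p m :
  half_twist p m.+1 = artin_prod (strands_word p m.+1) * half_twist p m.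
Proof. by []. Qed.

Lemma half_twist_commute p m j : (j < p) || (p + m < j) ->
  commute (half_twist p m) (artin n j).
Proof.
elim: m => [_|m IHm jpm]; first exact/commute_sym/commute1.
rewrite half_twistS; apply/commute_sym/commuteM; apply/commute_sym.
  exact: strands_commute.
by apply: IHm; lia.
Qed.

(** The smallest letter is out of reach of [strands_shift]; two consecutive factors of the half
    twist carry it to the other end. *)
Lemma strands_twice p m : p + m.+2 <= n ->
  artin n p.+1 * (artin_prod (strands_word p m.+2) * artin_prod (strands_word
    p m.+1))
  = artin_prod (strands_word p m.+2) * artin_prod (strands_word p m.+1) *
    artin n (p + m.+1).
Proof.
elim: m => [_|m IHm pmn].
  by rewrite /strands_word /= artin_prod0 artin_prod1 !mulg1 addn1.
have c : commute (artin_prod (strands_word p m.+1)) (artin n (p + m.+2)).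
  by apply: strands_commute; lia.
(* The last letter of the first factor commutes with all of the second factor except its last
   letter, so both last letters can be collected on the right. *)
have -> : artin_prod (strands_word p m.+3) * artin_prod (strands_word p m.+2)
  = artin_prod (strands_word p m.+2) * artin_prod (strands_word p m.+1)
    * (artin n (p + m.+2) * artin n (p + m.+1)).
  rewrite (strands_artin_prodS p (ltn0Sn m.+1)).
  rewrite [in X in _ * X = _](strands_artin_prodS p (ltn0Sn m)).
  by rewrite -!mulgA [artin n _ * (artin_prod _ * _)]mulgA -c -!mulgA.
rewrite [LHS]mulgA IHm -?mulgA; last lia.
do 2 congr (_ * _); rewrite !mulgA [p + m.+2]addnS artin_braid //; lia.
Qed.

(** For i > 1 the first factor lowers the index by one and the shorter half twist does the rest. For
    i = 1 two factors turn x_(p+1) into x_(p+m-1), which commutes with the remaining half twist. *)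
Lemma half_twist_artin p m i : 0 < i < m -> p + m <= n ->
  artin n (p + i) * half_twist p m = half_twist p m * artin n (p + (m - i)).
Proof.
elim: m => [|m IHm] in i *; first lia.
case: i => [|[|i]]; first lia; last first.
  move=> im pmn; rewrite half_twistS mulgA strands_shift; [|lia..].
  by rewrite -mulgA IHm ?subSS ?mulgA //; lia.
case: m IHm => [|m _ _ pmn] //.
rewrite addn1 2!half_twistS [_ * (_ * half_twist p m)]mulgA [LHS]mulgA.
rewrite strands_twice // subn1 -!mulgA; do 2 congr (_ * _).
by rewrite half_twist_commute //; lia.
Qed.

(** * Words attached to sequences of block lengths *)

Fixpoint blocks_word (p : nat) (c : seq nat) : seq nat :=
  if c is a :: c' then strands_word p a ++ blocks_word (p + a) c' else [::].

Lemma blocks_word_cat p (c d : seq nat) :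
  blocks_word p (c ++ d) = blocks_word p c ++ blocks_word (p + sumn c) d.
Proof.
by elim: c p => [|a c IHc] p /=; rewrite ?addn0 // IHc catA addnA.
Qed.

(** A block of one strand has no generator, so untouched strands can be recorded as blocks of length
    1. *)
Lemma blocks_word_ones p k : blocks_word p (nseq k 1%N) = [::].
Proof. by elim: k p => //= k IHk p; rewrite IHk. Qed.

Lemma mem_blocks_word p (c : seq nat) j : j \in blocks_word p c ->
  p < j < p + sumn c.
Proof.
elim: c p => //= a c IHc p; rewrite mem_cat mem_iota.
by case/orP=> [|/IHc]; lia.
Qed.

Lemma blocks_word_uniq p (c : seq nat) : uniq (blocks_word p c).
Proof.
elim: c p => //= a c IHc p; rewrite cat_uniq iota_uniq IHc andbT /=.
apply/hasPn=> j /mem_blocks_word jb; rewrite mem_iota; lia.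
Qed.

Lemma size_leq_sumn (c : seq nat) : all (leq 1) c -> size c <= sumn c.
Proof. by elim: c => //= a c IHc /andP[a1 /IHc]; lia. Qed.

Lemma size_blocks_word p (c : seq nat) : all (leq 1) c ->
  size (blocks_word p c) = sumn c - size c.
Proof.
elim: c p => //= a c IHc p /andP[a0 c0]; rewrite size_cat size_iota IHc //.
have := size_leq_sumn c0; lia.
Qed.

Lemma blocks_swap (c1 c2 : seq nat) (a b : nat) :
  sumn (c1 ++ a :: b :: c2) <= n ->
  conjugate_braids (artin_prod (blocks_word 0 (c1 ++ a :: b :: c2)))
    (artin_prod (blocks_word 0 (c1 ++ b :: a :: c2))).
Proof.
rewrite sumn_cat /= => cn; set p := sumn c1 in cn *; set m := a + b.
(* Conjugation by the half twist of the two blocks reflects their letters by [r] and fixes the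
   others. The gap p + a between the blocks goes to p + b, the gap after the exchange. *)
pose r j := if p < j < p + m then p + (p + m - j) else j.
have rK : involutive r.
  move=> j; rewrite /r; case jpm: (p < j < p + m); last by rewrite jpm.
  by rewrite ifT; lia.
set w := blocks_word 0 _.
have w_r : artin_prod w ^ half_twist p m = artin_prod (map r w).
  rewrite -[LHS]mulg1 /artin_prod big_map.
  have : {in w, forall j, artin n j ^ half_twist p m = artin n (r j)}.
    move=> j; rewrite /w blocks_word_cat mem_cat /= !mem_cat !mem_iota -/p.
    move=> jw; rewrite /r; case: ifP => jpm; last first.
      rewrite conjgE -half_twist_commute ?mulKg //.
      case/or4P: jw => [/mem_blocks_word|||/mem_blocks_word]; lia.
    rewrite conjgE; have -> : j = p + (j - p) by lia.
    rewrite half_twist_artin ?mulKg; [|lia..]; congr (artin n _); lia.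
  elim: (w) => [|j v IHv] jw; first by rewrite !big_nil conj1g mulg1.
  rewrite !big_cons conjMg jw ?mem_head // -mulgA IHv //.
  by move=> k kw; apply: jw; rewrite inE kw orbT.
apply: (@conj_trans _ (artin_prod (map r w))); first by exists (half_twist p m).
(* The reflected word has the letters of the target word, in another order. *)
apply: uniq_conj_perm; rewrite ?map_inj_uniq ?blocks_word_uniq //.
  exact: inv_inj.
move=> j; rewrite -[j in LHS]rK mem_map; last exact: inv_inj.
rewrite /w !blocks_word_cat /= !mem_cat !mem_iota -/p !add0n.
have -> : p + b + a = p + a + b by lia.
have out q (c : seq nat) k : ~~ (q < k < q + sumn c) ->
  (k \in blocks_word q c) = false.
  by move=> qk; apply: contraNF qk => /mem_blocks_word.
rewrite /r; case: ifP => jpm; last by do 2 congr (_ || _); lia.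
by rewrite !out /= ?orbF; lia.
Qed.
End Artin.

(** * Reduction to sorted block lengths *)

Section Blocks.
Variable n : nat.
Implicit Types c d A : seq nat.

Lemma blocks_move c d d' a : sumn (c ++ a :: d ++ d') <= n ->
  conjugate_braids (artin_prod n (blocks_word 0 (c ++ a :: d ++ d')))
    (artin_prod n (blocks_word 0 (c ++ d ++ a :: d'))).
Proof.
elim: d c => [|b d IHd] c cn; first exact: conj_refl.
apply: conj_trans (blocks_swap cn) _ => /=.
rewrite -!(cat_rcons b); apply: IHd; rewrite cat_rcons.
by apply: leq_trans cn; rewrite !sumn_cat /= !sumn_cat /=; lia.
Qed.

(** The head of [c] is set aside at the end of [e] while the tail is permuted, and then moves to its
    place in [d]. *)
Lemma blocks_perm e c d : perm_eq c d -> sumn (e ++ c) <= n ->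
  conjugate_braids (artin_prod n (blocks_word 0 (e ++ c)))
    (artin_prod n (blocks_word 0 (e ++ d))).
Proof.
elim: c d e => [|a c IHc] d e cd en.
  by move: cd; rewrite perm_sym => /perm_nilP->; apply: conj_refl.
have ad : a \in d by rewrite -(perm_mem cd) mem_head.
case/splitPr: ad cd => d1 d2 cd.
have cd' : perm_eq c (d1 ++ d2).
  rewrite -(perm_cons a); apply: perm_trans cd _.
  by rewrite -(cat1s a d2) perm_catCA.
rewrite -cat_rcons; apply: (conj_trans (IHc _ _ cd' _));
  first by rewrite cat_rcons.
rewrite cat_rcons; apply: blocks_move.
by apply: leq_trans en; rewrite !sumn_cat /= (perm_sumn cd').
Qed.

(** The blocks are built from the right: strand p + 1 joins the first block if [S] contains p + 1,
    and otherwise forms a block of its own. *)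
Lemma letters_blocks (S : pred nat) p m :
  exists c, [/\ all (leq 1) c, sumn c = m
    & forall j, (j \in blocks_word p c) = S j && (p < j < p + m)].
Proof.
elim: m p => [|m IHm] p.
  by exists [::]; split=> // j; rewrite addn0; apply/esym/negbTE; lia.
have [c [c1 cm cS]] := IHm p.+1.
case: c => [|a c] in c1 cm cS *.
  exists [:: 1%N]; split=> //=; first by rewrite -cm.
  by move=> j; rewrite -cm addn1; apply/esym/negbTE; lia.
case/andP: c1 => a1 c1; rewrite /= in cm.
have [Sp|Sp] := boolP (S p.+1).
  exists (a.+1 :: c); split=> //=; first by rewrite -cm.
  move=> j; have -> : strands_word p a.+1 = p.+1 :: strands_word p.+1 a.
    by case: a a1 {cm cS}.
  rewrite addnS -addSn inE cS; case: eqP => [->|jp] /=; first by rewrite Sp;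
    lia.
  by congr (_ && _); lia.
exists [:: 1%N, a & c]; split=> //=; first by rewrite a1.
  by rewrite -cm.
move=> j; rewrite addn1 cS.
by have [->|jp] := eqVneq j p.+1; [rewrite (negbTE Sp)|congr (_ && _); lia].
Qed.

Lemma beta_blocks A : beta n A = artin_prod n (blocks_word 0 A).
Proof.
(* The offset [p] serves the induction: removing the first block leaves the others shifted by its
   length. *)
have gen p : \prod_(0 <= i < size A)
    artin_prod n (index_iota (p + block_sum A i).+1 (p + block_sum A i.+1))
    = artin_prod n (blocks_word p A).
  elim: A p => [|a A IHA] p; first by rewrite big_nil artin_prod0.
  rewrite big_nat_recl //= artin_prod_cat -IHA; congr (_ * _).
    rewrite /block_sum /= take0 /= !addn0 /index_iota /strands_word.
    by congr (artin_prod n (iota _ _)); lia.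
  by apply: eq_bigr => i _; rewrite /block_sum /= !addnA.
by rewrite -gen /beta big_add1 /=; apply: eq_bigr => i _; rewrite add0n.
Qed.

Lemma positive_product_artin (w : seq (artin_index n)) :
  positive_product w = artin_prod n [seq val i | i <- w].
Proof. by rewrite /positive_product /artin_prod big_map. Qed.

Lemma simple_conj_beta (b : braid n) : simple_braid b ->
  exists2 A : seq nat, block_sequence n A & conjugate_braids b (beta n A).
Proof.
case=> w uw ->; rewrite positive_product_artin.
have [c [c1 cn cS]] := letters_blocks [in [seq val i | i <- w]] 0 n.
pose A := sort geq [seq a <- c | 1 < a].
(* The parts equal to 1 go to the end, where they add no letter to the word of [A]. *)
have Ac : perm_eq (A ++ nseq (count (predC (leq 2)) c) 1%N) c.
  apply: perm_trans (permEl (perm_filterC (leq 2) c)); apply: perm_cat.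
    by rewrite perm_sort.
  rewrite -size_filter; suff /all_pred1P <- :
    all (pred1 1%N) (filter (predC (leq 2)) c) by [].
  by rewrite all_filter; apply: sub_all c1 => a /=; lia.
exists A.
  rewrite /block_sequence sort_sorted; last by move=> x y; apply: leq_total.
  rewrite all_sort filter_all /= -cn -(perm_sumn Ac) sumn_cat; exact: leq_addr.
rewrite beta_blocks.
have -> : blocks_word 0 A =
  blocks_word 0 (A ++ nseq (count (predC (leq 2)) c) 1%N).
  by rewrite blocks_word_cat blocks_word_ones cats0.
apply: conj_trans (conj_sym (@blocks_perm [::] _ _ _ _)); first last.
- by rewrite (perm_sumn Ac) cn.
- exact: Ac.
apply: uniq_conj_perm; rewrite ?(map_inj_uniq val_inj) ?blocks_word_uniq //.
move=> j; rewrite cS; apply/idP/andP=> [jw|[]//]; split=> //.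
by case/mapP: jw => i _ ->; apply: (valP i).
Qed.

End Blocks.

(** * Permutations of positive braids *)

Definition positive_letter n : pred (artin_index n * bool) := fun l => l.2.

Definition negative_letter n : pred (artin_index n * bool) := fun l => ~~ l.2.

(** Invariance of the exponent sum, with the negative terms moved across to stay in [nat]. *)
Lemma braid_eq_count n (u v : braid_word n) : braid_eq u v ->
  count (@positive_letter n) u + count (@negative_letter n) v
  = count (@positive_letter n) v + count (@negative_letter n) u.
Proof.
elim=> //= {u v} [u v w|u u' v v'|i []] *; rewrite ?count_cat /=; lia.
Qed.

Lemma porbitJ (T : finType) (s g : {perm T}) x :
  porbit (s ^ g) (g x) = g @: porbit s x.
Proof.
apply/setP=> y; apply/porbitP/imsetP => [[i ->]|[z /porbitP[i ->] ->]].
  by exists ((s ^+ i) x); rewrite ?mem_porbit // -conjXg permJ.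
by exists i; rewrite -conjXg permJ.
Qed.

Lemma card_porbitsJ (T : finType) (s g : {perm T}) :
  #|porbits (s ^ g)| = #|porbits s|.
Proof.
rewrite -(card_imset (mem (porbits s)) (imset_inj (@perm_inj _ g))).
apply: eq_card => X; apply/imsetP/imsetP => [[x _ ->]|[_ /imsetP[x _ ->] ->]].
  by exists (porbit s (g^-1 x)); rewrite ?imset_f // -porbitJ permKV.
by exists (g x); rewrite ?porbitJ.
Qed.

Lemma card_porbits1 (T : finType) : #|porbits (1 : {perm T})| = #|T|.
Proof.
rewrite card_imset // => x y exy.
have : x \in porbit 1 y by rewrite -exy porbit_id.
by case/porbitP=> i ->; rewrite expg1n perm1.
Qed.

(** * Cycles of products of adjacent transpositions *)

Section Permutation.
Variable n : nat.
Implicit Types (x y : 'I_n.+1) (w : seq nat).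

(** Positions start at 0 here, so x_j exchanges j - 1 and j. *)
Definition adjacent_tperm (j : nat) : 'S_n.+1 := tperm (inord j.-1) (inord j).

Definition letter_perm w : 'S_n.+1 := \prod_(j <- w) adjacent_tperm j.

Definition braid_perm (u : braid_word n.+1) : 'S_n.+1 :=
  letter_perm [seq val l.1 | l <- u].

Lemma braid_perm_cat u v : braid_perm (u ++ v) = braid_perm u * braid_perm v.
Proof. by rewrite /braid_perm /letter_perm map_cat big_cat. Qed.

Lemma inord_eq i j : i <= n -> j <= n -> (inord i == inord j :> 'I_n.+1) =
  (i == j).
Proof. by move=> i_n j_n; rewrite -val_eqE /= !inordK. Qed.

Lemma braid_eq_perm u v : braid_eq u v -> braid_perm u = braid_perm v.
Proof.
elim=> // {u v} [u v w _ -> //|u u' v v' _ uv _ uv'|[i i_n] b|[i i_n] [j j_n]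
  /=|].
- by rewrite !braid_perm_cat uv uv'.
- by rewrite /braid_perm /letter_perm /= !big_cons big_nil mulg1 tperm2.
- move=> ij; rewrite /braid_perm /letter_perm /= !big_cons big_nil !mulg1.
  rewrite conjgC tpermJ; congr (_ * _).
  by rewrite !tpermD // inord_eq; lia.
case=> [i i_n] [j j_n] /= ej;
  rewrite /braid_perm /letter_perm /= !big_cons big_nil !mulg1.
rewrite {j}ej in j_n *; set s := adjacent_tperm i; set t := adjacent_tperm i.+1.
have -> : s * (t * s) = t ^ s by rewrite conjgE tpermV.
have -> : t * (s * t) = s ^ t by rewrite conjgE tpermV.
rewrite !tpermJ /= tpermL tpermR tpermD ?tpermD //; last 2 first.
- by rewrite inord_eq; lia.
- by rewrite inord_eq; lia.
- by rewrite inord_eq; lia.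
by rewrite inord_eq; lia.
Qed.

(** Only x_k moves a strand across the cut between positions k - 1 and k. *)
Lemma letter_perm_cut w k x : all (fun j => 0 < j < n.+1) w -> k \notin w ->
  (letter_perm w x < k) = (x < k).
Proof.
rewrite /letter_perm; elim: w => [|j w IHw] in x *;
  first by rewrite big_nil perm1.
rewrite big_cons permM inE negb_or => /andP[jn wn] /andP[kj kw].
by rewrite IHw //; case: tpermP => [->|->|] //; rewrite !inordK; lia.
Qed.

Lemma porbit_letter_perm_cut w k x y : all (fun j => 0 < j < n.+1) w ->
  k \notin w -> y \in porbit (letter_perm w) x -> (y < k) = (x < k).
Proof.
move=> wn kw /porbitP[i ->]; elim: i => [|i IHi]; first by rewrite perm1.
by rewrite expgSr permM letter_perm_cut.
Qed.

(** Each letter j merges two cycles: it is absent from the rest of the word, whose cycles therefore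
    stay on one side of the cut between j - 1 and j. *)
Lemma card_porbits_uniq w : all (fun j => 0 < j < n.+1) w -> uniq w ->
  #|porbits (letter_perm w)| + size w = n.+1.
Proof.
rewrite /letter_perm; elim: w => [|j w IHw] /=.
  by rewrite big_nil card_porbits1 card_ord addn0.
case/andP=> jn wn /andP[jw uw]; rewrite big_cons.
have := porbits_mul_tperm (letter_perm w) (inord j.-1) (inord j).
rewrite /= inord_eq; [|lia..].
have -> : inord j.-1 \notin porbit (letter_perm w) (inord j).
  by apply/negP=> /(porbit_letter_perm_cut wn jw); rewrite !inordK; lia.
have -> : (j.-1 != j) = true by lia.
rewrite -/(letter_perm w) -/(adjacent_tperm j); move: (IHw wn uw);
  rewrite -/(letter_perm w) /=.
by move=> cw ctw; lia.
Qed.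

(* The smallest points of the blocks of strands that [w] connects lie in
   distinct cycles. *)
Lemma card_porbits_ge w : all (fun j => 0 < j < n.+1) w ->
  n.+1 <= #|porbits (letter_perm w)| + size (undup w).
Proof.
move=> wn; pose C : {set 'I_n.+1} := [set x | val x \notin w].
have cC : #|C| + #|~: C| = n.+1 by rewrite cardsC card_ord.
suff : #|C| + #|~: C| <= #|porbits (letter_perm w)| + size (undup w) by
  rewrite cC.
apply: leq_add.
  rewrite -(card_in_imset (f := porbit (letter_perm w)) (D := C)).
    by apply/subset_leq_card/subsetP=> _ /imsetP[x _ ->]; apply: imset_f.
  move=> x y; rewrite !inE => xw yw exy; apply/val_inj/eqP.
  have xy : x \in porbit (letter_perm w) y by rewrite -exy porbit_id.
  have := porbit_letter_perm_cut wn yw xy.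
  have := porbit_letter_perm_cut wn xw xy; rewrite /=; lia.
rewrite cardE -(size_map val); apply: uniq_leq_size.
  by rewrite (map_inj_uniq val_inj) enum_uniq.
by move=> _ /mapP[x xC ->]; move: xC; rewrite mem_enum !inE negbK mem_undup.
Qed.

End Permutation.

(** * Positive words conjugate to square free ones *)

Lemma braid_ofV n (w : braid_word n) : braid_of (inv_word w) = (braid_of w)^-1.
Proof. exact: braid_of_inv. Qed.

Lemma artin_index_word n (w : seq nat) : all (fun j => 0 < j < n) w ->
  {v : seq (artin_index n) | w = [seq val i | i <- v]}.
Proof.
elim: w => [|j w IHw] /=; first by exists [::].
by case/andP=> jn /IHw[v ->]; exists (Sub j jn :: v).
Qed.

Definition positive_word n (w : seq (artin_index n)) : braid_word n :=
  [seq (i, true) | i <- w].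

Lemma positive_product_word n (w : seq (artin_index n)) :
  positive_product w = braid_of (positive_word w).
Proof.
rewrite /positive_product; elim: w => [|i w IHw]; first by rewrite big_nil.
by rewrite big_cons IHw artin_in -braid_ofM.
Qed.

Lemma beta_positive_product n A : sumn A <= n ->
  exists w : seq (artin_index n),
    [/\ beta n A = positive_product w, uniq w
      & [seq val i | i <- w] = blocks_word 0 A].
Proof.
move=> An; have /artin_index_word[w ew] : all (fun j =>
  0 < j < n) (blocks_word 0 A).
  by apply/allP=> j /mem_blocks_word; lia.
exists w; split=> //; first by rewrite beta_blocks positive_product_artin ew.
by rewrite -(map_inj_uniq val_inj) -ew blocks_word_uniq.
Qed.

Lemma conj_uniq n (v w : seq (artin_index n)) : uniq v ->
  conjugate_braids (positive_product w) (positive_product v) -> uniq w.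
Proof.
case: n v w => [|n] v w uv.
  (* There is no generator on 0 strands, so [w] is empty. *)
  by case: w => [| [i i_lt0] w] //; case: notF; case/andP: i_lt0.
case=> g; rewrite !positive_product_word -[g]braid_of_repr;
  move: (generic_quotient.repr g) => u.
move=> conj_uwv.
have /braid_ofP uwv :
    braid_of (inv_word u ++ (positive_word w ++ u)) =
      braid_of (positive_word v).
  by rewrite !braid_ofM braid_ofV -conjgE.
have count_positive (s : seq (artin_index n.+1)) :
    count (@positive_letter n.+1) (positive_word s) =
      size s /\ count (@negative_letter n.+1) (positive_word s) = 0.
  by rewrite /positive_word; elim: s => //= i s [-> ->].
(* The exponent sums of [u] and of its inverse cancel. *)
have sz : size w = size v.
  have := braid_eq_count (inv_wordl u); have := braid_eq_count uwv.
  have [w1 w0] := count_positive w; have [v1 v0] := count_positive v.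
  rewrite !count_cat w1 w0 v1 v0 /= => cwv cu; lia.
have porb : #|porbits (braid_perm (positive_word w))|
          = #|porbits (braid_perm (positive_word v))|.
  rewrite -(braid_eq_perm uwv) !braid_perm_cat -[LHS](card_porbitsJ _
    (braid_perm u)).
  congr #|porbits (_ * _)|; apply: (mulIg (braid_perm u)); rewrite mulVg.
  by rewrite -braid_perm_cat (braid_eq_perm (inv_wordl u)) /braid_perm
    /letter_perm big_nil.
have letters (s : seq (artin_index n.+1)) :
    [seq val l.1 | l <- positive_word s] = [seq val i | i <- s].
  by rewrite -map_comp.
have in_range (s : seq (artin_index n.+1)) :
    all (fun j => 0 < j < n.+1) [seq val i | i <- s].
  by apply/allP=> _ /mapP[i _ ->]; apply: (valP i).
(* The common number of cycles is n + 1 - [size v], so [w] has at least [size v], that is [size w],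
   distinct letters. *)
have := card_porbits_uniq (in_range v); rewrite (map_inj_uniq val_inj) =>
  /(_ uv).
have := card_porbits_ge (in_range w).
move: porb; rewrite /braid_perm !letters => -> wn vn.
move: wn; rewrite -[X in X <= _]vn.
rewrite size_map -sz leq_add2l undup_map_inj; last exact: val_inj.
by rewrite size_map leqNgt ltn_size_undup negbK.
Qed.

(** * HOMFLY polynomials of closures *)

Lemma run_cons s e d : run s (e :: d) = obind (run^~ d) (step s e).
Proof.
by rewrite /run /=; case: (step s e) => //=; elim: d.
Qed.

Lemma run_cat s d1 d2 s' : run s d1 = Some s' -> run s (d1 ++ d2) = run s' d2.
Proof.
elim: d1 => [|e d1 IHd] in s *; first by case=> ->.
by rewrite cat_cons !run_cons; case: (step s e) => //= t; apply: IHd.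
Qed.

Lemma step_max s1 s2 b :
  step (s1 ++ s2) (LocalMax (size s1) b) = Some (s1 ++ [:: b, ~~ b & s2]).
Proof. by rewrite /= size_cat leq_addr take_size_cat // drop_size_cat. Qed.

Lemma step_min s1 s2 a b : a != b ->
  step (s1 ++ [:: a, b & s2]) (LocalMin (size s1)) = Some (s1 ++ s2).
Proof. by move=> ab; rewrite /= drop_size_cat // ab take_size_cat. Qed.

Lemma step_crossing s1 s2 a b c :
  step (s1 ++ [:: a, b & s2]) (Crossing (size s1) c)
  = Some (s1 ++ [:: b, a & s2]).
Proof. by rewrite /= drop_size_cat // take_size_cat. Qed.

(** The orientations along a horizontal line through a closure: the k strands of the braid go down,
    the k closing arcs on their right go up. *)
Definition nested k : seq bool := nseq k true ++ nseq k false.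

Lemma nestedS k : nested k.+1 = nseq k true ++ [:: true, false & nseq k false].
Proof. by rewrite /nested -addn1 nseqD -catA addn1. Qed.

Lemma nth_nested k i : i < k -> nth true (nested k) i = true.
Proof. by move=> ik; rewrite nth_cat size_nseq ik nth_nseq ik. Qed.

Lemma step_nested_max k : step (nested k) (LocalMax k true) =
  Some (nested k.+1).
Proof. by rewrite nestedS -[X in LocalMax X](size_nseq k true) step_max. Qed.

Lemma step_nested_min k : step (nested k.+1) (LocalMin k) = Some (nested k).
Proof. by rewrite nestedS -[X in LocalMin X](size_nseq k true) step_min. Qed.

Lemma step_nested_crossing k i c : i.+1 < k ->
  step (nested k) (Crossing i c) = Some (nested k).
Proof.
move=> ik; have -> : nested k = nseq i true ++ [:: true, true &
    nseq (k - i.+2) true ++ nseq k false].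
  have {1}-> : nested k = nseq (i + (2 + (k - i.+2))) true ++ nseq k false.
    by rewrite /nested; congr (nseq _ _ ++ _); lia.
  by rewrite nseqD -catA.
by rewrite -[X in Crossing X](size_nseq i true) step_crossing.
Qed.

Definition crossing_below k (e : event) : bool :=
  if e is Crossing i _ then i.+1 < k else false.

Lemma run_nested_crossings k d : all (crossing_below k) d ->
  run (nested k) d = Some (nested k).
Proof.
elim: d => // -[//|//|i c] d IHd /andP[ik dk].
by rewrite run_cons step_nested_crossing //= IHd.
Qed.

Definition cups k : diagram := [seq LocalMax i true | i <- iota 0 k].

Definition caps k : diagram := [seq LocalMin i | i <- rev (iota 0 k)].

Lemma cupsS k : cups k.+1 = cups k ++ [:: LocalMax k true].
Proof. by rewrite /cups -addn1 iotaD map_cat. Qed.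

Lemma capsS k : caps k.+1 = LocalMin k :: caps k.
Proof. by rewrite /caps -addn1 iotaD rev_cat. Qed.

Lemma run_cups k : run [::] (cups k) = Some (nested k).
Proof.
elim: k => // k IHk; rewrite cupsS (run_cat _ IHk) run_cons step_nested_max.
by [].
Qed.

Lemma run_caps k : run (nested k) (caps k) = Some [::].
Proof. by elim: k => // k IHk; rewrite capsS run_cons step_nested_min. Qed.

Definition closure k (d : diagram) : diagram := cups k ++ d ++ caps k.

Lemma braid_letters_below n (w : braid_word n) :
  all (crossing_below n) [seq braid_letter l | l <- w].
Proof. by rewrite all_map; apply/allP=> -[[i i_n] c] _ /=; lia. Qed.

Section Homfly.
Variables (R : realType) (P : diagram -> frac_lm R) (homflyP : is_homfly P).

(** Since [u] and [v] act alike on the orientations [s], both diagrams close up, as [same_link]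
    requires. *)
Lemma homfly_move u v d1 d2 s s' : local_move u v ->
  run [::] d1 = Some s -> run s u = Some s' -> run s v = Some s' ->
  run s' d2 = Some [::] -> P (d1 ++ u ++ d2) = P (d1 ++ v ++ d2).
Proof.
move=> uv d1s us vs d2s.
have ud : link_diagram (d1 ++ u ++ d2).
  by rewrite /link_diagram (run_cat _ d1s) (run_cat _ us) d2s.
have vd : link_diagram (d1 ++ v ++ d2).
  by rewrite /link_diagram (run_cat _ d1s) (run_cat _ vs) d2s.
by apply: (homfly_invariant homflyP) => //; apply: SameMove.
Qed.

Lemma homfly_crossings_move k u v d d' : local_move u v ->
  all (crossing_below k) u -> all (crossing_below k) v ->
  all (crossing_below k) d -> all (crossing_below k) d' ->
  P (closure k (d ++ u ++ d')) = P (closure k (d ++ v ++ d')).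
Proof.
move=> uv uk vk dk dk'; rewrite /closure -!catA !(catA (cups k) d).
apply: (@homfly_move _ _ _ _ (nested k) (nested k)) => //.
- by rewrite (run_cat _ (run_cups k)) run_nested_crossings.
- exact: run_nested_crossings.
- exact: run_nested_crossings.
- by rewrite (run_cat _ (run_nested_crossings dk')) run_caps.
Qed.

(** The context [d], [d'] serves the case of a concatenation, whose two factors are replaced one
    after the other. Cancellation is a Reidemeister II move, far commutation a planar isotopy, the
    Artin relation a Reidemeister III move. *)
Lemma homfly_braid_eq_context n (u v : braid_word n) d d' : braid_eq u v ->
  all (crossing_below n) d -> all (crossing_below n) d' ->
  P (closure n (d ++ [seq braid_letter l | l <- u] ++ d'))
  = P (closure n (d ++ [seq braid_letter l | l <- v] ++ d')).
Proof.
move=> uv; elim: uv d d' => {u v} [//|u v _ IH d d' dn dn'|||i b|i j ij|i j ij].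
- by rewrite IH.
- by move=> u v w _ IHuv _ IHvw d d' dn dn'; rewrite IHuv ?IHvw.
- move=> u u' v v' _ IHu _ IHv d d' dn dn'; rewrite !map_cat -!catA IHu //.
    rewrite catA IHv ?catA // all_cat dn; exact: braid_letters_below.
  by rewrite all_cat dn' andbT; apply: braid_letters_below.
- by move=> d d'; apply: homfly_crossings_move (braid_letters_below _)
  (braid_letters_below _);
    apply: MoveR2.
- move=> d d'; apply: homfly_crossings_move (braid_letters_below _)
  (braid_letters_below _).
  (* [MoveFar] shifts its second event past the strands of the first, which end before position i +
     1; as x_j is the crossing at position j - 1, the offset is j - (i + 2). *)
  have := MoveFar (Crossing (val i).-1 true) (Crossing (val j - (val i).+2)
    true).
  rewrite /= /braid_letter /=.
  have -> // : (val i).-1.+2 + (val j - (val i).+2) = (val j).-1.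
  by case: i j ij => [i i_n] [j j_n] /=; lia.
move=> d d'; apply: homfly_crossings_move (braid_letters_below _)
  (braid_letters_below _).
rewrite /= /braid_letter /= ij.
have -> : (val i).+1.-1 = (val i).-1.+1 by case: i ij => i i_n /=; lia.
exact: MoveR3.
Qed.

Lemma homfly_braid_eq n (u v : braid_word n) : braid_eq u v ->
  P (braid_closure u) = P (braid_closure v).
Proof.
by move/homfly_braid_eq_context => /(_ [::] [::] isT isT); rewrite !cats0.
Qed.

(** * Removing the last strand of a closure *)

Lemma homfly_slide_max k d d1 d2 : all (crossing_below k) d ->
  run [::] d1 = Some (nested k) -> run (nested k.+1) d2 = Some [::] ->
  P (d1 ++ LocalMax k true :: d ++ d2) = P (d1 ++ d ++ LocalMax k true :: d2).
Proof.
move=> dk d1k d2k; elim: d d1 dk d1k =>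
  // -[//|//|i c] d IHd d1 /andP[ik dk] d1k.
have dk1 : all (crossing_below k.+1) d.
  by apply: sub_all dk => -[] //= j _ /leqW.
have := MoveFar (Crossing i c) (LocalMax (k - i.+2) true).
rewrite /= subnKC // => mv.
have d2k' : run (nested k.+1) (d ++ d2) = Some [::].
  by rewrite (run_cat _ (run_nested_crossings dk1)).
have /= <- := homfly_move mv d1k _ _ d2k'.
- rewrite -[Crossing i c :: _]cat1s catA IHd //; first by rewrite -catA.
  by rewrite (run_cat _ d1k) run_cons step_nested_crossing.
- by rewrite run_cons step_nested_crossing //= run_cons step_nested_max.
- by rewrite run_cons step_nested_max /= run_cons step_nested_crossing // leqW.
Qed.

Lemma homfly_slide_min k d d1 d2 : all (crossing_below k) d ->
  run [::] d1 = Some (nested k.+1) -> run (nested k) d2 = Some [::] ->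
  P (d1 ++ d ++ LocalMin k :: d2) = P (d1 ++ LocalMin k :: d ++ d2).
Proof.
move=> dk d1k d2k; elim: d d1 dk d1k =>
  // -[//|//|i c] d IHd d1 /andP[ik dk] d1k.
have := MoveFar (Crossing i c) (LocalMin (k - i.+2)).
rewrite /= subnKC // => mv.
have d2k' : run (nested k) (d ++ d2) = Some [::].
  by rewrite (run_cat _ (run_nested_crossings dk)).
have /= <- := homfly_move mv d1k _ _ d2k'.
- rewrite -[Crossing i c :: _]cat1s catA IHd //; first by rewrite -catA.
  by rewrite (run_cat _ d1k) run_cons step_nested_crossing // leqW.
- by rewrite run_cons step_nested_crossing ?leqW //= run_cons step_nested_min.
- by rewrite run_cons step_nested_min /= run_cons step_nested_crossing.
Qed.

(** The three events form a curl. Sliding the crossing across the maximum brings it onto the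
    minimum, where Reidemeister I removes it; the zigzag that is left is straightened. *)
Lemma homfly_kink k c d1 d2 :
  run [::] d1 = Some (nested k.+1) -> run (nested k.+1) d2 = Some [::] ->
  P (d1 ++ [:: LocalMax k.+1 true; Crossing k c; LocalMin k.+1] ++ d2)
  = P (d1 ++ d2).
Proof.
(* The orientations just below the maximum once it has been moved to position [k]. *)
move=> d1k d2k; pose s := nseq k true ++ [:: true, false, true & nseq k.+1
  false].
have ns : nested k.+1 = nseq k true ++ true :: nseq k.+1 false by rewrite
  nestedS.
have n2 : nested k.+2 = nseq k true ++ [:: true, true, false & nseq k.+1 false].
  by rewrite nestedS -addn1 nseqD -catA.
have sz1 : size (rcons (nseq k true) true) =
  k.+1 by rewrite size_rcons size_nseq.
have s_max : step (nested k.+1) (LocalMax k true) = Some s.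
  by rewrite ns -[X in LocalMax X](size_nseq k true) step_max.
have s_cross b : step s (Crossing k.+1 b) = Some (nested k.+2).
  by rewrite /s n2 -!(cat_rcons true (nseq k true)) -sz1 step_crossing.
have s_min : step s (LocalMin k.+1) = Some (nested k.+1).
  by rewrite /s ns -!(cat_rcons true (nseq k true)) -sz1 step_min.
have k1 : run (nested k.+2) (LocalMin k.+1 :: d2) = Some [::].
  by rewrite run_cons step_nested_min.
have := homfly_move (MoveSlideMax k true c) d1k _ _ k1 => /= ->.
- have d1s : run [::] (d1 ++ [:: LocalMax k true]) = Some s.
    by rewrite (run_cat _ d1k) run_cons s_max.
  rewrite -[LocalMax k true :: _]cat1s catA.
  have := homfly_move (MoveR1Min k.+1 (~~ c)) d1s _ _ d2k => /= ->.
  + have := homfly_move (MoveZigzagR k true) d1k _ _ d2k => /= <- //.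
      by rewrite -catA.
    by rewrite run_cons s_max /= run_cons s_min.
  + by rewrite run_cons s_cross /= run_cons step_nested_min.
  + by rewrite run_cons s_min.
- by rewrite run_cons step_nested_max /= run_cons step_nested_crossing.
- by rewrite run_cons s_max /= run_cons s_cross.
Qed.

Lemma closureS k d :
  closure k.+1 d = cups k ++ LocalMax k true :: d ++ LocalMin k :: caps k.
Proof. by rewrite /closure cupsS capsS -catA. Qed.

(** The innermost maximum slides down and the innermost minimum up to the crossing, leaving a
    curl. *)
Lemma homfly_destabilize k c d d' :
  all (crossing_below k.+1) d -> all (crossing_below k.+1) d' ->
  P (closure k.+2 (d ++ Crossing k c :: d')) = P (closure k.+1 (d ++ d')).
Proof.
move=> dk dk'; rewrite closureS -catA homfly_slide_max ?run_cups //; last first.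
  rewrite run_cons step_nested_crossing //= (run_cat _ (s' := nested k.+2)).
    by rewrite run_cons step_nested_min /= run_caps.
  by apply: run_nested_crossings; apply: sub_all dk' => -[] //= j _ /leqW.
have d1 : run [::] (cups k.+1 ++ d) = Some (nested k.+1).
  by rewrite (run_cat _ (run_cups _)) run_nested_crossings.
have d2 : run (nested k.+1) (d' ++ caps k.+1) = Some [::].
  by rewrite (run_cat _ (run_nested_crossings dk')) run_caps.
rewrite catA -[LocalMax _ _ :: _]/([:: _;
  _] ++ _) catA homfly_slide_min ?run_caps //.
  by rewrite -catA homfly_kink // /closure -!catA.
by rewrite (run_cat _ d1) run_cons step_nested_max /= run_cons
  step_nested_crossing.
Qed.

(** * Skein relation and evaluation of the polynomial *)

Local Open Scope ring_scope.
Import GRing.Theory.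

Lemma homfly_free_strand k d : all (crossing_below k.+1) d ->
  P (closure k.+2 d)
  = (- ((var_l R + (var_l R)^-1) / var_m R)) * P (closure k.+1 d).
Proof.
move=> dk; have d1 : run [::] (cups k.+1 ++ d) = Some (nested k.+1).
  by rewrite (run_cat _ (run_cups _)) run_nested_crossings.
have d1m : run [::] ((cups k.+1 ++ d) ++ [:: LocalMax k.+1 true]) =
  Some (nested k.+2).
  by rewrite (run_cat _ d1) run_cons step_nested_max.
have d2 : run (nested k.+2) (LocalMin k.+1 :: caps k.+1) = Some [::].
  by rewrite run_cons step_nested_min /= run_caps.
rewrite closureS homfly_slide_max ?run_cups // catA -[LocalMax _ _ :: _]cat1s
  catA.
have par : parallel_strands (nested k.+2) k.
  rewrite /parallel_strands !nth_nested // size_cat !size_nseq; lia.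
have link : link_diagram (((cups k.+1 ++ d) ++ [:: LocalMax k.+1 true])
                          ++ LocalMin k.+1 :: caps k.+1).
  by rewrite /link_diagram (run_cat _ d1m) d2.
have := homfly_skein homflyP d1m par link.
(* With a crossing of either sign next to it, the free circle becomes a curl in the neighbouring
   strand. *)
have kink c : P (((cups k.+1 ++ d) ++ [:: LocalMax k.+1 true])
                 ++ Crossing k c :: LocalMin k.+1 :: caps k.+1) =
                   P (closure k.+1 d).
  by have := homfly_kink c d1 (run_caps _); rewrite /closure -!catA.
rewrite !kink -mulrDl => /(canRL (addKr _)); rewrite addr0.
have m0 : var_m R != 0 by rewrite tofrac_eq0 polyX_eq0.
move=> eP; apply: (mulfI m0);
  rewrite eP mulrA mulrN mulrCA divff // mulr1 mulNr.
by [].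
Qed.

Lemma homfly_uniq_closure k (w : seq nat) : uniq w -> all (gtn k) w ->
  P (closure k.+1 [seq Crossing i true | i <- w])
  = (- ((var_l R + (var_l R)^-1) / var_m R)) ^+ (k - size w).
Proof.
have below j (v : seq nat) : all (gtn j) v ->
    all (crossing_below j.+1) [seq Crossing i true | i <- v].
  by rewrite all_map.
elim: k w => [|k IHk] w uw wk.
  (* One strand without crossings closes to the unknot. *)
  by case: w uw wk => // _ _; rewrite expr0 -(homfly_unknot homflyP).
have [k_w|k_w] := boolP (k \in w); last first.
  have {}wk : all (gtn k) w.
    apply/allP=> j jw; have := allP wk _ jw.
    by rewrite /= ltnS leq_eqVlt => /orP[/eqP ej|//]; rewrite -ej jw in k_w.
  (* Subtraction is truncated: the exponent grows by one with the new circle because [w] has at most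
     [k] letters. *)
  have wsz : (size w <= k)%N.
    rewrite -[k in (_ <= k)%N](size_iota 0); apply: uniq_leq_size =>
      // j /(allP wk).
    by rewrite mem_iota.
  by rewrite homfly_free_strand ?below // IHk // subSn // exprS.
case/splitPr: k_w uw wk => u v; rewrite -cat1s uniq_catCA /= =>
  /andP[kuv uuv] wk.
have uvk : all (gtn k) (u ++ v).
  apply/allP=> j juv; have jk : j != k by apply: contraNneq kuv => <-.
  have /(allP wk) /= : j \in u ++ k :: v.
    by move: juv; rewrite !mem_cat inE => /orP[] ->; rewrite ?orbT.
  by rewrite ltnS leq_eqVlt (negbTE jk).
move: (uvk); rewrite all_cat => /andP[uk vk].
rewrite map_cat /= homfly_destabilize ?below // -map_cat IHk //.
by rewrite !size_cat /= addnS subSS.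
Qed.

End Homfly.

Local Open Scope ring_scope.

Theorem theorem1p11 (R : realType) (n : nat) (n_gt0 : (0 < n)%N) :
  (forall b : braid n, positive_braid b ->
     (simple_braid b <->
      exists2 A : seq nat, block_sequence n A & conjugate_braids b (beta n A)))
  /\
  (forall P : diagram -> frac_lm R, is_homfly P ->
     forall A : seq nat, block_sequence n A ->
     braid_homfly_eq P (beta n A)
       ((- ((var_l R + (var_l R)^-1) / var_m R)) ^+ (n - sumn A + size A - 1))).
Proof.
split=> [b [w ->{b}]|P homflyP A /and3P[_ A2 An] u uA].
  split=> [|[A /and3P[_ _ An] wA]]; first exact: simple_conj_beta.
  have [v [eA uv _]] := beta_positive_product An.
  by exists w => //; apply: (conj_uniq uv); rewrite -eA.
have [v [eA uv vA]] := beta_positive_product An.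
have /(homfly_braid_eq homflyP) -> : braid_eq u (positive_word v).
  by apply/braid_ofP; rewrite uA eA positive_product_word.
case: n n_gt0 => // k _ in u uA v uv vA eA An *.
(* Crossings count positions from 0, generators from 1. *)
have -> : braid_closure (positive_word v)
        = closure k.+1 [seq Crossing i true | i <- [seq (val i).-1 | i <- v]].
  by rewrite /braid_closure /closure /positive_word -!map_comp.
have A1 : all (leq 1) A by apply: sub_all A2 => a /ltnW.
rewrite homfly_uniq_closure //.
(* The word has [sumn A - size A] letters; [size A <= sumn A] makes the exponents agree under
   truncated subtraction. *)
- have := size_blocks_word 0 A1; rewrite -vA !size_map => ->.
  have := size_leq_sumn A1; move=> szA; congr (_ ^+ _); lia.
- rewrite map_inj_in_uniq // => -[i i_n] [j j_n] _ _ /= ij.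
  by apply: val_inj => /=; lia.
by rewrite all_map; apply/allP=> -[i i_n] _ /=; lia.
Qed.
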